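(* Let $B_3=\{P_B=0\}\subset\widetilde V_4$, with $P_B$ a general global section of $\mathcal{O}_{\widetilde V_4}(D_B)$, be a Calabi-Yau orientifold hypersurface, and let $Y_4=D_B\cap D_W\subset V_6$ be its F-theory uplift after resolving all codimension-one $I_0^*$ singularities (all as constructed in the context). Let $$D_{g'}:=6\overline K_B-\sum_{i\in\mathrm{NHC}}3D_i$$ be the movable part of $6\overline K_B$, obtained by subtracting the fixed components associated with the non-Higgsable $I_0^*$ divisors. Suppose that: (a) $D_B$ is Cartier and nef on $\widetilde V_4$; (b) $D_{g'}$ is Cartier and nef on $\widetilde V_4$; (c) rigid O7 divisors do not intersect, i.e. no two distinct NHC rays $v_i,v_j$ are contained in a common cone of the fan of $\widetilde V_4$. Then the divisors $D_B$ and $D_W$ defining the resolved F-theory uplift are both Cartier and nef on $V_6$.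
   Context: Toric notation: varieties are over $\mathbb{C}$; for a toric variety with fan rays generated by primitive $v_i$, $x_i$ is the homogeneous (Cox) coordinate and $D_i=\{x_i=0\}$ the prime toric divisor. Torus-invariant Weil divisors are considered up to linear equivalence (Cartier and nef depend only on the class). $\overline K$ denotes the anticanonical class. Base: $\widetilde V_4$ is a complete, normal, simplicial toric fourfold with fan $\widetilde\Sigma_4$ in $\widetilde N_4\simeq\mathbb{Z}^4$ and primitive ray generators $v_1,\dots,v_n$. $D_B=\sum_i b_iD_i$ ($b_i\in\mathbb{Z}$) is a torus-invariant Weil divisor and $B_3\subset\widetilde V_4$ is the zero locus of a general global section $P_B$ of $\mathcal{O}_{\widetilde V_4}(D_B)$. It represents an O3/O7 orientifold: $\widetilde V_4=V_4/\mathbb{Z}_2$ is obtained from a toric fourfold $V_4$ with lattice $N$ and dual lattice $M$ by keeping the cones and refining the lattice to $\widetilde N_4=N\cup(N+\xi/2)$ for some $\xi\in N$, and sections of $\mathcal{O}(D_B)$ correspond to the monomials of the anticanonical Calabi-Yau polynomial of $V_4$ with characters $q\in M$ satisfying $\langle q,\xi\rangle\equiv 1 \bmod 2$. ($\widetilde V_4$ may subsequently be modified by toric blow-ups or a change of triangulation, with $D_B$ replaced by the corresponding divisor.) It is assumed that general sections of $\mathcal{O}(D_B)$ do not factorize and that the convex hull of the lattice points of the Newton polytope of $D_B$ is full-dimensional. Write $\overline K_B:=\overline K_{\widetilde V_4}-D_B=\sum_i(1-b_i)D_i$, regarded as a divisor class on $\widetilde V_4$. Non-Higgsable clusters (NHCs):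 $i\in\mathrm{NHC}$ means that every section of $6\overline K_B$ vanishes along $D_i$; then $v_i$ is called an NHC ray and $D_i$ is said to host a rigid O7-plane. All NHCs are of type $I_0^*$: general sections $f$ of $4\overline K_B$ and $g$ of $6\overline K_B$ have the form $f=f'\prod_{i\in\mathrm{NHC}}x_i^2$, $g=g'\prod_{i\in\mathrm{NHC}}x_i^3$, and $4f^3+27g^2=\mathrm{Disc}'\prod_{i\in\mathrm{NHC}}x_i^6$, with $f',g',\mathrm{Disc}'$ generically non-vanishing along all NHC divisors. Singular uplift: $V_6^s$ is the toric sixfold, a $\mathbb{P}_{[2,3,1]}$-fibration over $\widetilde V_4$, whose fan in $\mathbb{Z}^4\oplus\mathbb{Z}^2$ has rays $(v_i,0,1-b_i)$ for $i=1,\dots,n$ (again denoted $v_i$), together with $v_x=(0,3,1)$, $v_y=(0,-2,-1)$, $v_z=(0,0,1)$. Its maximal cones are generated by the lifted generators of a maximal cone of $\widetilde\Sigma_4$ together with one of the pairs $(v_x,v_y),(v_y,v_z),(v_z,v_x)$. The fiber coordinates are $x,y,z$ and the Weierstrass polynomial is $y^2-x^3-fxz^4-gz^6$, a section of $\mathcal{O}(3D_x)=\mathcal{O}(2D_y)$. Resolved uplift: $V_6\to V_6^s$ is the toric blow-up which, for each $i\in\mathrm{NHC}$, adds rays $v_{e_{i,1}}=v_i+v_x+2v_y$ and $v_{e_{i,2}}=2v_i+2v_x+3v_y$ (coordinates $e_{i,1},e_{i,2}$) and replaces each simplicial cone containing $v_i,v_x,v_y$ by the five cones obtained by replacing the triple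 $(v_i,v_x,v_y)$ with $(v_i,v_x,v_{e_{i,2}})$, $(v_i,v_y,v_{e_{i,1}})$, $(v_i,v_{e_{i,1}},v_{e_{i,2}})$, $(v_x,v_y,v_{e_{i,1}})$, $(v_x,v_{e_{i,1}},v_{e_{i,2}})$. On $V_6$, $D_B$ denotes the pullback of $D_B$ along the toric morphism $V_6\to V_6^s\to\widetilde V_4$. $D_W$ is the class of the resolved Weierstrass polynomial $$P_W=y^2\prod_{i\in\mathrm{NHC}}e_{i,1}-x^3-f'xz^4\prod_{i\in\mathrm{NHC}}x_i^2-g'z^6\prod_{i\in\mathrm{NHC}}x_i^3,$$ so $D_W\sim 3D_x$ on $V_6$. One has $D_B+D_W=\overline K_{V_6}$, and $Y_4=\{P_B=P_W=0\}\subset V_6$. *)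

(* Defs.v *)
(* MathComp, with Stdlib's R (through Rstruct) as the field of real numbers. *)
From HB Require Import structures.
From mathcomp Require Import all_boot all_order all_algebra.
From mathcomp Require Import complex mpoly Rstruct.
From Stdlib Require Rdefinitions.

Set Implicit Arguments.
Unset Strict Implicit.
Unset Printing Implicit Defensive.

Import Order.TTheory GRing.Theory Num.Theory.
Local Open Scope ring_scope.

Notation real := Rdefinitions.R.
Notation cplx := (complex real).

Definition pairing d (m u : 'rV[int]_d) : int := \sum_(k < d) m 0 k * u 0 k.

(** ** Toric varieties *)

(* A toric variety is given by its fan in Z^d. A simplicial cone is encoded by
   the set of its rays, and [cones] lists all the cones, faces included. *)
Record toric (d : nat) := Toric {
  ray : finType;
  gen : ray -> 'rV[int]_d;
  cones : {set {set ray}}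
}.

Definition primitive_in d (L : {pred 'rV[int]_d}) (u : 'rV[int]_d) : Prop :=
  u \in L /\
  forall (k : int) (u' : 'rV[int]_d), u' \in L -> u = u' *~ k -> k = 1 \/ k = -1.

Definition in_cone d (V : toric d) (s : {set ray V}) (u : 'rV[real]_d) : Prop :=
  exists c : ray V -> real,
    (forall i, 0 <= c i) /\ u = \sum_(i in s) c i *: map_mx intr (gen i).

Record simplicial_fan d (V : toric d) : Prop := SimplicialFan {
  fan_primitive : forall i : ray V, primitive_in predT (gen i);
  fan_rays : forall i : ray V, [set i] \in cones V;
  fan_faces : forall s t : {set ray V},
    s \in cones V -> t \subset s -> t \in cones V;
  fan_simplicial : forall (s : {set ray V}) (c : ray V -> real),
    s \in cones V -> \sum_(i in s) c i *: map_mx intr (gen i) = 0 :> 'rV[real]_d ->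
    forall i, i \in s -> c i = 0;
  fan_inter : forall (s t : {set ray V}) (u : 'rV[real]_d),
    s \in cones V -> t \in cones V ->
    in_cone s u -> in_cone t u -> in_cone (s :&: t) u
}.

Definition complete_fan d (V : toric d) : Prop :=
  forall u : 'rV[real]_d, exists2 s : {set ray V}, s \in cones V & in_cone s u.

(* The torus-invariant Weil divisor sum_i D_i {x_i = 0}. *)
Definition divisor d (V : toric d) := ray V -> int.

Definition lin_equiv d (V : toric d) (D E : divisor V) : Prop :=
  exists m : 'rV[int]_d, forall i, E i = D i + pairing m (gen i).

(* On the affine chart of the cone [s], D is the divisor of the rational
   function chi^(-m), so that chi^m generates O(D) there. *)
Definition local_datum d (V : toric d) (D : divisor V) (s : {set ray V})
    (m : 'rV[int]_d) : Prop :=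
  forall i, i \in s -> pairing m (gen i) = - D i.

Definition cartier d (V : toric d) (D : divisor V) : Prop :=
  forall s, s \in cones V -> exists m, local_datum D s m.

(** ** Nef divisors *)

(* Normalized discrete valuations trivial on the constants; the value at 0 is
   irrelevant. *)
Definition discrete_valuation (K : fieldType) (iota : cplx -> K)
    (w : K -> int) : Prop :=
  [/\ forall a b, a != 0 -> b != 0 -> w (a * b) = w a + w b,
      forall a b, a != 0 -> b != 0 -> a + b != 0 ->
        Num.min (w a) (w b) <= w (a + b),
      forall c, c != 0 -> w (iota c) = 0
    & exists2 a, a != 0 & w a = 1].

(* A smooth projective complex curve, given by its function field, a finitely
   generated extension of C of transcendence degree 1, and by its points, which
   are all the normalized discrete valuations of that field. The last two
   fields hold for every such curve: a rational function has finitely many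
   zeros and poles, and a principal divisor has degree 0. *)
Record curve := Curve {
  funfield : fieldType;
  const : {rmorphism cplx -> funfield};
  curve_trdeg1 : exists t : funfield,
    (forall p : {poly cplx}, p != 0 -> (map_poly const p).[t] != 0) /\
    exists e : seq funfield, forall y : funfield,
      exists (q : {poly cplx}) (p : 'I_(size e) -> {poly cplx}), q != 0 /\
        (map_poly const q).[t] * y
          = \sum_j (map_poly const (p j)).[t] * tnth (in_tuple e) j;
  pt : choiceType;
  ord : pt -> funfield -> int;
  ord_valuation : forall p, discrete_valuation const (ord p);
  ord_all : forall w, discrete_valuation const w ->
    exists p, forall a, a != 0 -> w a = ord p a;
  ord_inj : forall p p',
    (forall a, a != 0 -> ord p a = ord p' a) -> p = p';
  ord_finite : forall a, a != 0 ->
    exists S : seq pt, forall p, ord p a != 0 -> p \in S;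
  ord_degree0 : forall (a : funfield) (S : seq pt), a != 0 -> uniq S ->
    (forall p, ord p a != 0 -> p \in S) -> \sum_(p <- S) ord p a = 0
}.

(* A morphism from a curve to a complete toric variety is determined by the
   image of the generic point: a point, with values in the function field, of
   the torus orbit of some cone tau, that is, a homomorphism from the group
   of characters orthogonal to tau to the nonzero rational functions (its
   values on other characters are irrelevant). *)
Record curve_map d (V : toric d) (C : curve) := CurveMap {
  orbit_cone : {set ray V};
  orbit_cone_in : orbit_cone \in cones V;
  coord : 'rV[int]_d -> funfield C;
  coord_neq0 : forall m,
    (forall i, i \in orbit_cone -> pairing m (gen i) = 0) -> coord m != 0;
  coordD : forall m m',
    (forall i, i \in orbit_cone -> pairing m (gen i) = 0) ->
    (forall i, i \in orbit_cone -> pairing m' (gen i) = 0) ->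
    coord (m + m') = coord m * coord m'
}.

(* The point p is mapped into the affine chart of the cone s: the functions
   chi^m regular on the chart and not identically 0 or infinite on the orbit
   closure pull back to functions regular at p. *)
Definition lands_in d (V : toric d) (C : curve) (f : curve_map V C) (p : pt C)
    (s : {set ray V}) : Prop :=
  [/\ s \in cones V, orbit_cone f \subset s &
      forall m, (forall i, i \in s -> 0 <= pairing m (gen i)) ->
        (forall i, i \in orbit_cone f -> pairing m (gen i) = 0) ->
        0 <= ord p (coord f m)].

(* [deg_pullback f D e]: the line bundle f^* O(D) has degree e. The degree is
   computed from the rational section f^* chi^mt, where chi^mt generates O(D)
   at the generic point of the orbit, and which has order
   ord_p (f^* chi^(mt - m)) at p, chi^m being a local generator at f(p). *)
Definition deg_pullback d (V : toric d) (C : curve) (f : curve_map V C)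
    (D : divisor V) (e : int) : Prop :=
  exists (mt : 'rV[int]_d) (l : pt C -> int) (S : seq (pt C)),
    [/\ local_datum D (orbit_cone f) mt,
        forall p, exists s m,
          [/\ lands_in f p s, local_datum D s m & l p = ord p (coord f (mt - m))],
        uniq S,
        forall p, l p != 0 -> p \in S
      & e = \sum_(p <- S) l p].

(* For D Cartier and V complete: D has nonnegative degree on every curve. *)
Definition nef d (V : toric d) (D : divisor V) : Prop :=
  forall (C : curve) (f : curve_map V C) (e : int), deg_pullback f D e -> 0 <= e.

(* The pullback along the toric morphism V' -> V given by the linear map [phi]:
   its coefficient at a ray of generator v is the value at phi(v) of the
   piecewise linear function with value D_i at the generator of each ray i. *)
Definition is_pullback d d' (V : toric d) (V' : toric d')
    (phi : 'rV[int]_d' -> 'rV[int]_d) (D : divisor V) (D' : divisor V') : Prop :=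
  forall (j : ray V') (s : {set ray V}) (c : ray V -> real),
    s \in cones V -> (forall i, 0 <= c i) ->
    map_mx intr (phi (gen j))
      = \sum_(i in s) c i *: map_mx intr (gen i) :> 'rV[real]_d ->
    (D' j)%:~R = \sum_(i in s) c i * (D i)%:~R.

(** ** Sections, as homogeneous elements of the Cox ring *)

Section Sections.
Variables (d n : nat) (v : 'I_n -> 'rV[int]_d).
Implicit Types (a : 'I_n -> int).

(* The characters chi^m that are global sections of O(sum_i a_i D_i). *)
Definition newton a (m : 'rV[int]_d) : Prop := forall i, - a i <= pairing m (v i).

(* The monomial prod_i x_i^(a_i + <m, v_i>) is the section chi^m. *)
Definition has_class a (e : 'X_{1..n}) : Prop :=
  exists m : 'rV[int]_d, forall i, (e i)%:Z = a i + pairing m (v i).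

Definition is_section a (s : {mpoly cplx[n]}) : Prop :=
  forall e, e \in msupp s -> has_class a e.

(* P holds on a nonempty Zariski open set of sections of O(sum_i a_i D_i): the
   locus where some nonzero polynomial in the coefficients does not vanish. *)
Definition for_general_section a (P : {mpoly cplx[n]} -> Prop) : Prop :=
  exists (k : nat) (e : k.-tuple 'X_{1..n}) (h : {mpoly cplx[k]}),
    [/\ uniq e, forall e', e' \in (e : seq _) -> has_class a e', h != 0 &
        forall s, is_section a s -> h.@[fun j => s@_(tnth e j)] != 0 -> P s].

Definition vanishes_along (i : 'I_n) (s : {mpoly cplx[n]}) : Prop :=
  exists t, s = 'X_i * t.

(* Factors of a section are themselves sections, i.e. homogeneous. *)
Definition not_factorizable (s : {mpoly cplx[n]}) : Prop :=
  forall a1 a2 s1 s2, is_section a1 s1 -> is_section a2 s2 -> s = s1 * s2 ->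
    (exists c, s1 = c%:MP) \/ (exists c, s2 = c%:MP).

(* The lattice points of the Newton polytope affinely span the whole space. *)
Definition full_dim_newton a : Prop :=
  exists (m0 : 'rV[int]_d) (m : 'I_d -> 'rV[int]_d),
    [/\ newton a m0, forall k, newton a (m k)
      & \det (\matrix_(k < d, j < d) (m k 0 j - m0 0 j)) != 0].

End Sections.

(** ** Orientifold bases *)

Definition qpairing d (q : 'rV[rat]_d) (u : 'rV[int]_d) : rat :=
  \sum_(k < d) q 0 k * (u 0 k)%:~R.

(* Z^4 is the refined lattice N cup (N + xi/2). The fan of V_4 / Z_2 is V0, and
   the generators of the rays of V_4, primitive in N, are the w_k. The fan with
   rays v may differ from V0 by blow-ups and changes of triangulation, which
   keep the rays of V0 and the monomials of P_B. Only the rays of V0 matter, so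
   that V0 may be taken simplicial. The characters of sections of
   O(sum_i b_i D_i) are, up to a translation by q0, the q in the dual lattice
   of N with <q, xi> odd among the anticanonical monomials of V_4. *)
Definition orientifold n (v : 'I_n -> 'rV[int]_4) (b : 'I_n -> int) : Prop :=
  exists (N : {pred 'rV[int]_4}) (xi eta : 'rV[int]_4) (V0 : toric 4)
         (w : ray V0 -> 'rV[int]_4) (q0 : 'rV[rat]_4),
  [/\ [/\ zmod_closed N, xi \in N, xi = eta *+ 2, eta \notin N
        & forall u, u \in N \/ u - eta \in N],
      [/\ simplicial_fan V0, complete_fan V0 & forall k : ray V0, exists i, gen k = v i],
      forall k, primitive_in N (w k) /\
        exists2 c : int, 0 < c & w k = gen k *~ c
    & forall q : 'rV[rat]_4,
        [/\ forall u, u \in N -> qpairing q u \is a Num.int,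
            exists z : int, qpairing q xi = (2 * z + 1)%:~R
          & forall k, -1 <= qpairing q (w k)]
        <-> exists2 m : 'rV[int]_4, newton v b m & q = q0 + map_mx intr m].

(** ** The F-theory uplift *)

Section Uplift.
Variables (n : nat) (v : 'I_n -> 'rV[int]_4) (Sigma : {set {set 'I_n}}).
Variables (b : 'I_n -> int) (NHC : {set 'I_n}).

Definition base : toric 4 := Toric v Sigma.

(* The class of -K - D_B, as -K is the sum of all the prime toric divisors. *)
Definition KB : 'I_n -> int := fun i => 1 - b i.

Definition NHC_ray (i : 'I_n) : Prop :=
  forall s, is_section v (fun j => 6 * KB j) s -> vanishes_along i s.

(* For general f in H^0(4 KB) and general g in H^0(6 KB). *)
Definition type_I0star : Prop :=
  for_general_section v (fun j => 4 * KB j) (fun f =>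
  for_general_section v (fun j => 6 * KB j) (fun g =>
    exists f' g' disc' : {mpoly cplx[n]},
      [/\ f = f' * \prod_(i in NHC) 'X_i ^+ 2,
          g = g' * \prod_(i in NHC) 'X_i ^+ 3,
          4 * f ^+ 3 + 27 * g ^+ 2 = disc' * \prod_(i in NHC) 'X_i ^+ 6
        & forall i, i \in NHC ->
            [/\ ~ vanishes_along i f', ~ vanishes_along i g'
              & ~ vanishes_along i disc']])).

Definition Dg' : 'I_n -> int := fun i => 6 * KB i - 3 * (i \in NHC)%:R.

Definition vec2 (a c : int) : 'rV[int]_2 := \row_j (if j == 0 then a else c).

Definition sray : finType := ('I_n + 'I_3)%type.
Definition sbase (i : 'I_n) : sray := inl i.
Definition sx : sray := inr 0.
Definition sy : sray := inr 1.
Definition sz : sray := inr 2.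

Definition sgen (r : sray) : 'rV[int]_(4 + 2) :=
  match r with
  | inl i => row_mx (v i) (vec2 0 (1 - b i))
  | inr k => row_mx 0 (tnth [tuple vec2 3 1; vec2 (-2) (-1); vec2 0 1] k)
  end.

Definition base_maxcones : {set {set 'I_n}} :=
  [set t | maxset (fun s => s \in Sigma) t].

Definition fiber_pairs : {set {set sray}} :=
  [set [set sx; sy]] :|: [set [set sy; sz]] :|: [set [set sz; sx]].

Definition smaxcones : {set {set sray}} :=
  [set (sbase @: t) :|: F | t : {set 'I_n} in base_maxcones,
                            F : {set sray} in fiber_pairs].

Definition uray : finType := (sray + {i | i \in NHC} * bool)%type.
Definition old (r : sray) : uray := inl r.
Definition e1 (i : {i | i \in NHC}) : uray := inr (i, false).
Definition e2 (i : {i | i \in NHC}) : uray := inr (i, true).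

Definition ugen (r : uray) : 'rV[int]_(4 + 2) :=
  match r with
  | inl r => sgen r
  | inr (i, false) => sgen (sbase (val i)) + sgen sx + sgen sy *+ 2
  | inr (i, true) => sgen (sbase (val i)) *+ 2 + sgen sx *+ 2 + sgen sy *+ 3
  end.

Definition blown_triple (i : {i | i \in NHC}) : {set sray} :=
  [set sbase (val i); sx; sy].

Definition five (i : {i | i \in NHC}) : {set {set uray}} :=
  let vi := old (sbase (val i)) in
  [set [set vi; old sx; e2 i]] :|: [set [set vi; old sy; e1 i]]
  :|: [set [set vi; e1 i; e2 i]] :|: [set [set old sx; old sy; e1 i]]
  :|: [set [set old sx; e1 i; e2 i]].

(* The replacements for the various i are performed simultaneously. This is
   the iterated blow-up when no cone of the base contains two rays of NHC. *)
Definition umaxcones : {set {set uray}} :=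
  [set old @: t | t : {set sray} in smaxcones
                 & [forall i, ~~ (blown_triple i \subset t)]]
  :|: \bigcup_i [set (old @: (t :\: blown_triple i)) :|: F |
                  t : {set sray} in
                    [set t in smaxcones | blown_triple i \subset t],
                  F : {set uray} in five i].

Definition V6 : toric (4 + 2) :=
  Toric ugen [set s : {set uray} | [exists t in umaxcones, s \subset t]].

Definition V6_to_base (u : 'rV[int]_(4 + 2)) : 'rV[int]_4 := lsubmx u.

(* The divisor of x^3; its class is that of every monomial of
   P_W = y^2 prod e1_i - x^3 - f' x z^4 prod x_i^2 - g' z^6 prod x_i^3. *)
Definition three_Dx : uray -> int := fun r => 3 * (r == old sx)%:R.

End Uplift.

Arguments three_Dx [n] NHC r.

(* Main.v *)
(* On V_6, with pi the projection to the base,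
     D_W ~ 3 D_x ~ 2 D_y + sum_NHC E_{i,1} ~ pi^* D_{g'} + 6 D_z + 3 sum_NHC D_i,
   and each of the three forms is a nef Cartier divisor (0, 0 and pi^* D_{g'})
   plus an effective one. No cone of V_6 meets the supports of all three
   effective parts, since rigid O7 divisors do not intersect. Hence D_W is
   Cartier, and a curve, whose generic point lies in the orbit of a cone tau,
   has nonnegative degree on the form whose effective part avoids tau.
   Pullbacks such as D_B and pi^* D_{g'} are nef by the projection formula. *)
From HB Require Import structures.
From mathcomp Require Import all_boot all_order all_algebra.
From mathcomp Require Import Rstruct zify ring.
From Stdlib Require Import IndefiniteDescription.
Require Import Defs.

Set Implicit Arguments.
Unset Strict Implicit.
Unset Printing Implicit Defensive.

Import Order.TTheory GRing.Theory Num.Theory.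
Local Open Scope ring_scope.

(** Both sums run over the same elements once the zero terms are dropped. A degree may thus be
    computed on any duplicate-free list that contains the support. *)
Lemma sum_uniq_support (T : eqType) (S S' : seq T) (F : T -> int) :
  uniq S -> uniq S' ->
  (forall x, F x != 0 -> x \in S) -> (forall x, F x != 0 -> x \in S') ->
  \sum_(x <- S) F x = \sum_(x <- S') F x.
Proof.
move=> uS uS' hS hS'.
have red (s : seq T) : \sum_(x <- s) F x = \sum_(x <- [seq x <- s | F x != 0]) F x.
  rewrite big_filter (bigID (fun x => F x != 0)) /= [X in _ + X]big1 ?addr0 //.
  by move=> x; rewrite negbK => /eqP.
rewrite red [RHS]red; apply/perm_big/uniq_perm; rewrite ?filter_uniq // => x.
rewrite !mem_filter; case: (boolP (F x != 0)) => // nz.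
by rewrite hS // hS'.
Qed.

(** * Bilinearity of the pairing *)

Section Pairing.
Variable d : nat.
Implicit Types m u : 'rV[int]_d.

Lemma pairing0l u : pairing 0 u = 0.
Proof. by rewrite /pairing big1 // => k _; rewrite mxE mul0r. Qed.

Lemma pairingDl m m' u : pairing (m + m') u = pairing m u + pairing m' u.
Proof. by rewrite -big_split; apply: eq_bigr => k _; rewrite mxE mulrDl. Qed.

Lemma pairingNl m u : pairing (- m) u = - pairing m u.
Proof. by rewrite -sumrN; apply: eq_bigr => k _; rewrite mxE mulNr. Qed.

Lemma pairingBl m m' u : pairing (m - m') u = pairing m u - pairing m' u.
Proof. by rewrite pairingDl pairingNl. Qed.

Lemma pairingDr m u u' : pairing m (u + u') = pairing m u + pairing m u'.
Proof. by rewrite -big_split; apply: eq_bigr => k _; rewrite mxE mulrDr. Qed.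

Lemma pairingMnr m u k : pairing m (u *+ k) = pairing m u *+ k.
Proof.
rewrite -sumrMnl; apply: eq_bigr => i _.
by rewrite mulmxnE mulrnAr.
Qed.

End Pairing.

Lemma pairing_row_mx d d' (m u : 'rV[int]_d) (m' u' : 'rV[int]_d') :
  pairing (row_mx m m') (row_mx u u') = pairing m u + pairing m' u'.
Proof.
rewrite /pairing big_split_ord; congr (_ + _); apply: eq_bigr => k _ /=.
  by rewrite !row_mxEl.
by rewrite !row_mxEr.
Qed.

(** * Orders of characters along a curve, and comparison of degrees *)

Section CurveMap.
Variables (d : nat) (V : toric d) (C : curve) (f : curve_map V C).
Local Notation tau := (orbit_cone f).
Implicit Types (m : 'rV[int]_d) (D : divisor V).

Definition orthogonal (s : {set ray V}) m :=
  forall i, i \in s -> pairing m (gen i) = 0.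

Lemma ord_coordD p m m' : orthogonal tau m -> orthogonal tau m' ->
  ord p (coord f (m + m')) = ord p (coord f m) + ord p (coord f m').
Proof.
move=> om om'; rewrite (coordD om om').
by case: (ord_valuation p) => -> //; apply: coord_neq0.
Qed.

(** Both [m] and [- m] are nonnegative on [s], so the character is a unit on the chart: the two
    orders are nonnegative and add up to 0. *)
Lemma ord_coord_orthogonal p s m : lands_in f p s -> orthogonal s m ->
  ord p (coord f m) = 0.
Proof.
case=> _ /subsetP ts hs om.
have ot : orthogonal tau m by move=> i /ts /om.
have oN (t : {set ray V}) : orthogonal t m -> orthogonal t (- m).
  by move=> o i /o; rewrite pairingNl => ->; rewrite oppr0.
have o0 : orthogonal tau 0 by move=> i _; rewrite pairing0l.
(* The value of [coord f] at 0 is not prescribed; additivity applied to 0 + 0 forces its order to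
   vanish. *)
have E0 : ord p (coord f 0) = 0.
  by apply: (addrI (ord p (coord f 0))); rewrite -ord_coordD // !addr0.
have := ord_coordD p ot (oN _ ot); rewrite subrr E0 => /eqP.
have h1 : 0 <= ord p (coord f m) by apply: hs => // i /om ->.
have h2 : 0 <= ord p (coord f (- m)).
  by apply: hs; [move=> i /(oN s om) -> | apply: oN].
by lia.
Qed.

Lemma finite_support m : orthogonal tau m ->
  exists S : seq (pt C), forall p, ord p (coord f m) != 0 -> p \in S.
Proof. by move/(coord_neq0 (c := f))/ord_finite. Qed.

Lemma sum_ord_coord m (S : seq (pt C)) : orthogonal tau m -> uniq S ->
  (forall p, ord p (coord f m) != 0 -> p \in S) ->
  \sum_(p <- S) ord p (coord f m) = 0.
Proof. by move/(coord_neq0 (c := f)); apply: ord_degree0. Qed.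

Lemma local_datumB D (s t : {set ray V}) m m' : t \subset s ->
  local_datum D t m -> local_datum D s m' -> orthogonal t (m - m').
Proof.
move=> /subsetP ts hm hm' i it.
by rewrite pairingBl hm // hm' ?ts // subrr.
Qed.

(* The local data of A may be prescribed: they need not be those used to
   compute the degree of D. *)
Lemma deg_pullback_ge D A e (M : {set ray V} -> 'rV[int]_d) :
  deg_pullback f D e ->
  (forall s, s \in cones V -> local_datum A s (M s)) ->
  (forall i, A i <= D i) -> (forall i, i \in tau -> A i = D i) ->
  exists (sp : pt C -> {set ray V}) (S : seq (pt C)),
    let l p := ord p (coord f (M tau - M (sp p))) in
    [/\ forall p, lands_in f p (sp p), uniq S,
        forall p, l p != 0 -> p \in S & \sum_(p <- S) l p <= e].
Proof.
case=> mt [l0 [S0 [hmt hl0 uS0 hS0 ->]]] hM AD ADt.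
have tauV := orbit_cone_in f.
have o1 : orthogonal tau (mt - M tau).
  by move=> i it; rewrite pairingBl hmt // hM // ADt // subrr.
(* At each point keep the chart used for [D]. There [l0 p] is the sum of the two orders on the left
   and of the order of [M s - m]. The latter character takes the values [D i - A i >= 0] on the rays
   of [s], so it is regular at [p]. *)
have /functional_choice [sp hsp] : forall p, exists s, lands_in f p s /\
    ord p (coord f (mt - M tau)) + ord p (coord f (M tau - M s)) <= l0 p.
  move=> p; have [s [m [Ls hm ->]]] := hl0 p; exists s; split=> //.
  have [sV ts hs] := Ls.
  have -> : mt - m = (mt - M tau) + (M tau - M s) + (M s - m).
    by rewrite !subrKA.
  have o2 := local_datumB ts (hM _ tauV) (hM _ sV).
  have o3 : orthogonal tau (M s - m).
    move=> i it; have is_ := subsetP ts _ it.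
    by rewrite pairingBl hM // hm // ADt // subrr.
  have o12 : orthogonal tau ((mt - M tau) + (M tau - M s)).
    by move=> i it; rewrite pairingDl o1 // o2 // addr0.
  rewrite (ord_coordD _ o12 o3) (ord_coordD _ o1 o2) lerDl; apply: hs => // i is_.
  by rewrite pairingBl hM // hm // opprK addrC subr_ge0.
have [S1 hS1] := finite_support o1.
(* The character [M tau - M (sp p)] varies with [p], but only through the cone [sp p]. As there are
   finitely many cones, the union of the supports over all of them is finite. *)
have /fin_all_exists [S2 hS2] : forall s : {set ray V}, exists S : seq (pt C),
    s \in cones V -> tau \subset s ->
    forall p, ord p (coord f (M tau - M s)) != 0 -> p \in S.
  move=> s; case: (boolP ((s \in cones V) && (tau \subset s))); last first.
    by move=> h; exists [::] => sV ts; rewrite sV ts in h.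
  case/andP=> sV ts.
  have [S hS] := finite_support (local_datumB ts (hM _ tauV) (hM _ sV)).
  by exists S.
pose S := undup (S0 ++ S1 ++ flatten [seq S2 s | s <- enum {: {set ray V}}]).
exists sp, S; split=> [p||p nz|]; first by case: (hsp p).
- exact: undup_uniq.
- rewrite mem_undup !mem_cat; apply/orP; right; apply/orP; right.
  apply/flattenP; exists (S2 (sp p)); first by apply: map_f; rewrite mem_enum.
  by case: (hsp p) => -[sV ts _] _; apply: hS2.
have inS p : (p \in S0) || (p \in S1) -> p \in S.
  by rewrite mem_undup !mem_cat orbA => ->.
rewrite (@sum_uniq_support _ S0 S l0) ?undup_uniq //; last first.
  by move=> p /hS0 h; apply: inS; rewrite h.
(* The function [coord f (mt - M tau)] is the same at every point, so it contributes a principal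
   divisor, of degree 0, to the summed inequality. *)
have E1 : \sum_(p <- S) ord p (coord f (mt - M tau)) = 0.
  apply: sum_ord_coord => //; first exact: undup_uniq.
  by move=> p /hS1 h; apply: inS; rewrite h orbT.
by rewrite -[leLHS]add0r -[X in X + _]E1 -big_split; apply: ler_sum => p _; case: (hsp p).
Qed.

End CurveMap.

(** * Linear equivalence, and a criterion for Cartier and nef divisors *)

Section Nef.
Variables (d : nat) (V : toric d).
Implicit Types (D A E : divisor V).

Lemma cartier_local_data D : cartier D ->
  exists M : {set ray V} -> 'rV[int]_d,
    forall s, s \in cones V -> local_datum D s (M s).
Proof.
move=> cD; apply: (fin_all_exists (P := fun s m => s \in cones V -> local_datum D s m)).
move=> s; case: (boolP (s \in cones V)) => [/cD [m hm]|_]; first by exists m.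
by exists 0.
Qed.

Lemma cartier0 : cartier (fun _ : ray V => 0).
Proof. by move=> s _; exists 0 => i _; rewrite pairing0l oppr0. Qed.

(** Every local generator of the trivial bundle is a unit at the point considered, so the degree is
    that of the principal divisor of the single function [coord f mt], namely 0. *)
Lemma nef0 : nef (fun _ : ray V => 0).
Proof.
move=> C f e [mt [l [S [hmt hl uS hS ->]]]].
have omt : orthogonal (orbit_cone f) mt by move=> i /hmt; rewrite oppr0.
have lE p : l p = ord p (coord f mt).
  have [s [m [Ls hm ->]]] := hl p.
  have [_ ts _] := Ls.
  have om : orthogonal s (- m).
    by move=> i /hm; rewrite pairingNl => ->; rewrite !oppr0.
  rewrite ord_coordD ?(ord_coord_orthogonal Ls om) ?addr0 //.
  by move=> i /(subsetP ts) /om.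
rewrite (eq_bigr _ (fun p _ => lE p)) sum_ord_coord // => p.
by rewrite -lE; apply: hS.
Qed.

Lemma local_datum_lin_equiv D E s (m0 m : 'rV[int]_d) :
  (forall i, E i = D i + pairing m0 (gen i)) ->
  local_datum D s m -> local_datum E s (m - m0).
Proof. by move=> hE hm i /hm; rewrite pairingBl hE opprD => ->. Qed.

(** The generic datum and all the local data are shifted by the same character, so the differences
    [mt - m] do not change. *)
Lemma deg_pullback_lin_equiv C (f : curve_map V C) D E e :
  lin_equiv D E -> deg_pullback f D e -> deg_pullback f E e.
Proof.
move=> [m0 hE] [mt [l [S [hmt hl uS hS ->]]]].
exists (mt - m0), l, S; split=> //; first exact: local_datum_lin_equiv hmt.
move=> p; have [s [m [Ls hm ->]]] := hl p.
exists s, (m - m0); split=> //; first exact: local_datum_lin_equiv hm.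
by rewrite opprB addrA subrK.
Qed.

Lemma lin_equiv_sym D E : lin_equiv D E -> lin_equiv E D.
Proof.
by case=> m hE; exists (- m) => i; rewrite hE pairingNl addrK.
Qed.

Lemma lin_equiv_trans D E A : lin_equiv D E -> lin_equiv E A -> lin_equiv D A.
Proof.
by move=> [m hE] [m' hA]; exists (m + m') => i; rewrite hA hE pairingDl addrA.
Qed.

Lemma cartier_nef_plus_effective D :
  (forall s, s \in cones V -> exists A E,
    [/\ cartier A, nef A, lin_equiv D E, forall i, A i <= E i
      & forall i, i \in s -> A i = E i]) ->
  cartier D /\ nef D.
Proof.
move=> hD; split=> [s sV | C f e De].
  have [A [E [cA _ /lin_equiv_sym [m0 hDE] _ AE]]] := hD s sV.
  have [m hm] := cA s sV; exists (m - m0).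
  apply: local_datum_lin_equiv hDE _ => i is_.
  by rewrite hm // AE.
have [A [E [cA nA DE leAE AE]]] := hD _ (orbit_cone_in f).
have [M hM] := cartier_local_data cA.
have [sp [S [Lsp uS hS le_e]]] :=
  deg_pullback_ge (deg_pullback_lin_equiv DE De) hM leAE AE.
(* The lower bound is itself the degree of [A] on [f], computed with the charts [sp]. *)
apply: le_trans le_e; apply: (nA C f).
exists (M (orbit_cone f)), (fun p => ord p (coord f (M (orbit_cone f) - M (sp p)))), S.
split=> //; first exact/hM/orbit_cone_in.
move=> p; exists (sp p), (M (sp p)); split=> //.
by apply: hM; case: (Lsp p).
Qed.

End Nef.

(* A toric morphism V' -> V, given by the dual map [pm] on characters and by
   the coordinates [c] of the images of the generators of V'. *)
Section Pullback.
Variables (d d' : nat) (V : toric d) (V' : toric d').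
Variables (pm : {additive 'rV[int]_d -> 'rV[int]_d'}).
Variables (c : ray V' -> ray V -> int).
Hypothesis c_ge0 : forall r i, 0 <= c r i.
Hypothesis pairing_pm : forall m r,
  pairing (pm m) (gen r) = \sum_i c r i * pairing m (gen i).

(** When this is a cone of [V], its relative interior contains the image of that of [s]: the
    morphism sends the orbit of [s] into its orbit. *)
Definition image_cone (s : {set ray V'}) : {set ray V} :=
  [set i | [exists r in s, c r i != 0]].

Hypothesis image_cone_in : forall s, s \in cones V' -> image_cone s \in cones V.

Variables (D : divisor V) (D' : divisor V').
Hypothesis D'E : forall r, D' r = \sum_i c r i * D i.

Lemma mem_image_cone (s : {set ray V'}) r i : r \in s -> c r i != 0 -> i \in image_cone s.
Proof. by move=> rs nz; rewrite inE; apply/exists_inP; exists r. Qed.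

Lemma image_coneS (s t : {set ray V'}) : s \subset t -> image_cone s \subset image_cone t.
Proof.
move/subsetP=> st; apply/subsetP => i; rewrite inE => /exists_inP [r /st rt nz].
exact: mem_image_cone nz.
Qed.

Lemma orthogonal_pm s m : orthogonal (image_cone s) m -> orthogonal s (pm m).
Proof.
move=> om r rs; rewrite pairing_pm big1 // => i _.
have [->|nz] := eqVneq (c r i) 0; first by rewrite mul0r.
by rewrite om ?mulr0 //; apply: mem_image_cone nz.
Qed.

(** A local generator pulls back to a local generator. Rays outside the image cone have coefficient
    0 and do not matter. *)
Lemma local_datum_pm s m :
  local_datum D (image_cone s) m -> local_datum D' s (pm m).
Proof.
move=> hm r rs; rewrite pairing_pm D'E -sumrN; apply: eq_bigr => i _.
have [->|nz] := eqVneq (c r i) 0; first by rewrite !mul0r oppr0.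
by rewrite hm ?mulrN //; apply: mem_image_cone nz.
Qed.

Lemma cartier_pullback : cartier D -> cartier D'.
Proof.
move=> cD s /image_cone_in /cD [m hm]; exists (pm m).
exact: local_datum_pm.
Qed.

Section Composite.
Variables (C : curve) (f : curve_map V' C).

Lemma composite_coord_neq0 m :
  (forall i, i \in image_cone (orbit_cone f) -> pairing m (gen i) = 0) ->
  coord f (pm m) != 0.
Proof. by move=> om; apply/coord_neq0/orthogonal_pm. Qed.

Lemma composite_coordD m m' :
  (forall i, i \in image_cone (orbit_cone f) -> pairing m (gen i) = 0) ->
  (forall i, i \in image_cone (orbit_cone f) -> pairing m' (gen i) = 0) ->
  coord f (pm (m + m')) = coord f (pm m) * coord f (pm m').
Proof. by move=> om om'; rewrite raddfD; apply: coordD; apply: orthogonal_pm. Qed.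

Definition composite : curve_map V C :=
  CurveMap (image_cone_in (orbit_cone_in f)) composite_coord_neq0 composite_coordD.

Lemma composite_lands_in p s :
  lands_in f p s -> lands_in composite p (image_cone s).
Proof.
case=> sV ts hs; split=> [||m m_ge0 om]; first exact: image_cone_in.
  exact: image_coneS.
apply: hs; last exact: orthogonal_pm.
move=> r rs; rewrite pairing_pm sumr_ge0 // => i _.
have [->|nz] := eqVneq (c r i) 0; first by rewrite mul0r.
by rewrite mulr_ge0 //; apply/m_ge0/(mem_image_cone rs).
Qed.

End Composite.

(** This is the projection formula, as an inequality: the degree of [D'] on [f] is at least that of
    [D] on the composite curve. *)
Lemma nef_pullback : cartier D -> nef D -> nef D'.
Proof.
move=> cD nD C f e De.
have [M hM] := cartier_local_data cD.
have hM' s : s \in cones V' -> local_datum D' s (pm (M (image_cone s))).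
  by move/image_cone_in/hM/local_datum_pm.
(* The comparison is applied with [A] equal to [D'] itself, to replace arbitrary local data of [D']
   by pullbacks of local data of [D]. *)
have [sp [S [Lsp uS hS le_e]]] :=
  deg_pullback_ge De hM' (fun _ => lexx _) (fun _ _ => erefl).
apply: le_trans le_e; apply: (nD C (composite f)).
pose m p := M (image_cone (sp p)).
exists (M (image_cone (orbit_cone f))),
  (fun p => ord p (coord f (pm (M (image_cone (orbit_cone f))) - pm (m p)))), S.
split=> //; first exact/hM/image_cone_in/orbit_cone_in.
move=> p; exists (image_cone (sp p)), (m p); split.
- exact: composite_lands_in.
- by apply/hM/image_cone_in; case: (Lsp p).
- by rewrite /= raddfB.
Qed.

End Pullback.

(** * The cones of the resolved uplift *)

Section Uplift.
Variables (n : nat) (v : 'I_n -> 'rV[int]_4) (Sigma : {set {set 'I_n}}).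
Variables (b : 'I_n -> int) (NHC : {set 'I_n}).
Local Notation V := (base v Sigma).
Local Notation V6 := (V6 v Sigma b NHC).
Local Notation uray := (uray NHC).
Local Notation old := (@old n NHC).
Local Notation sbase := (@sbase n).
Local Notation sx := (sx n).
Local Notation sy := (sy n).
Local Notation sz := (sz n).

Hypothesis Sigma_faces : forall s t : {set 'I_n}, s \in Sigma -> t \subset s -> t \in Sigma.
Hypothesis NHC_disjoint : forall i j s, i \in NHC -> j \in NHC -> i != j ->
  s \in Sigma -> ~~ ((i \in s) && (j \in s)).

Lemma cones_V6P (s : {set uray}) : s \in cones V6 ->
  exists t F, [/\ t \in Sigma, F \in fiber_pairs n &
    [\/ s \subset old @: (sbase @: t :|: F) /\
        forall i : {i | i \in NHC}, ~~ (blown_triple i \subset sbase @: t :|: F)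
      | exists (i : {i | i \in NHC}) (G : {set uray}),
        [/\ blown_triple i \subset sbase @: t :|: F, G \in five i
          & s \subset (old @: ((sbase @: t :|: F) :\: blown_triple i)) :|: G]]].
Proof.
have maxS t : t \in base_maxcones Sigma -> t \in Sigma.
  by rewrite inE => /maxsetP [].
rewrite inE => /exists_inP [u]; rewrite inE => /orP [].
  case/imsetP=> T; rewrite inE => /andP [/imset2P [t F /maxS tS FF ->]].
  move=> /forallP hT -> su; exists t, F; split=> //; left; split=> // i.
case/bigcupP=> i _ /imset2P [T G]; rewrite inE => /andP [].
case/imset2P=> t F /maxS tS FF -> bT G5 -> su.
by exists t, F; split=> //; right; exists i, G.
Qed.

(** The coefficient of [v i] in the projection of the generator of [r]. Since $v_x$ and $v_y$
    project to 0, $e_{j,1}$ goes to $v_j$ and $e_{j,2}$ to $2v_j$; the Boolean [e] read as a number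
    gives these multiplicities as [e.+1]. *)
Definition proj_coef (r : uray) (i : 'I_n) : int :=
  match r with
  | inl (inl j) => (i == j)%:R
  | inl (inr _) => 0
  | inr (j, e) => (i == val j)%:R *+ e.+1
  end.

Lemma fiber_pairP F : F \in fiber_pairs n ->
  [\/ F = [set sx; sy], F = [set sy; sz] | F = [set sz; sx]].
Proof.
by rewrite !inE => /orP [/orP [] | ] /eqP ->;
  [constructor 1 | constructor 2 | constructor 3].
Qed.

Lemma mem_base_fiber (t : {set 'I_n}) (F : {set sray n}) j : F \in fiber_pairs n ->
  (sbase j \in sbase @: t :|: F) = (j \in t).
Proof.
move=> FF; rewrite inE mem_imset; last by move=> ? ? [].
by case: (fiber_pairP FF) => ->; rewrite !inE /= !orbF.
Qed.

Lemma mem_fiber_base (t : {set 'I_n}) (F : {set sray n}) k : (inr k \in sbase @: t :|: F) = (inr k \in F).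
Proof. by rewrite inE; case: imsetP => // -[]. Qed.

(** The triple contains both $v_x$ and $v_y$, and only one fiber pair does. *)
Lemma blown_fiber i (t : {set 'I_n}) (F : {set sray n}) : F \in fiber_pairs n ->
  @blown_triple n NHC i \subset sbase @: t :|: F -> F = [set sx; sy] /\ val i \in t.
Proof.
move=> FF /subsetP bT.
have : sbase (val i) \in sbase @: t :|: F by apply: bT; rewrite !inE eqxx.
rewrite mem_base_fiber // => it; split=> //.
have := bT sx; have := bT sy; rewrite !mem_fiber_base !inE !eqxx !orbT.
move=> /(_ isT) hy /(_ isT); move: hy.
by case: (fiber_pairP FF) => ->; rewrite !inE.
Qed.

Lemma five_sub i (G : {set uray}) : G \in five i ->
  G \subset [set old (sbase (val i)); old sx; old sy; e1 i; e2 i].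
Proof.
move=> hG; apply/subsetP => r.
move: hG; rewrite !inE => /orP [/orP [/orP [/orP [] | ] | ] | ] /eqP ->;
  rewrite !inE; by do ![case/orP | move=> -> | rewrite ?orbT].
Qed.

(** Exceptional rays over $v_k$ project to multiples of $v_k$, and they occur only in replacements
    of cones whose base part [t] already contains $v_k$. *)
Lemma cone_V6_image s : s \in cones V6 ->
  exists2 t, t \in Sigma & forall r i, r \in s -> proj_coef r i != 0 -> i \in t.
Proof.
move=> /cones_V6P [t [F [tS FF hs]]]; exists t => // r i rs.
have old_case (X : {set sray n}) : X \subset sbase @: t :|: F ->
    r \in old @: X -> proj_coef r i != 0 -> i \in t.
  move=> /subsetP XT /imsetP [[j|k] /XT]; last by move=> _ ->.
  by rewrite mem_base_fiber // => jt -> /=; have [->|] := eqVneq i j.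
case: hs => [[/subsetP su _] | [k [G [bT hG /subsetP su]]]].
  by apply: old_case (su _ rs).
case/setUP: (su _ rs) => [|/(subsetP (five_sub hG))].
  by apply: old_case; apply: subsetDl.
have [_ kt] := blown_fiber FF bT.
by rewrite !inE => /orP [/orP [/orP [/orP [] | ] | ] | ] /eqP -> //=;
  case: (eqVneq i (val k)) => // ->.
Qed.

(** Suppose that $v_x$ is present. In an unsubdivided cone, adding $v_y$ excludes $v_z$ and, since
    no blown-up triple remains, every NHC ray. In a subdivided cone $v_z$ is absent, and an NHC ray
    singles out a replacement without $v_y$ and $e_{k,1}$. *)
Lemma cone_V6_cases s : s \in cones V6 ->
  [\/ old sx \notin s,
      old sy \notin s /\ forall i, e1 i \notin s
    | old sz \notin s /\ forall j, j \in NHC -> old (sbase j) \notin s].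
Proof.
move=> /cones_V6P [t [F [tS FF hs]]].
have old_inj : injective old by move=> ? ? [].
have inrN (X : {set sray n}) (a : {i | i \in NHC} * bool) : (inr a : uray) \notin old @: X.
  by apply/imsetP => -[].
case: hs => [[/subsetP su nbT] | [k [G [bT hG /subsetP su]]]].
  have [xs|] := boolP (old sx \in s); last by constructor 1.
  have [ys|ys] := boolP (old sy \in s); last first.
    by constructor 2; split=> // i; apply/negP => /su; apply/negP/inrN.
  have := su _ xs; have := su _ ys; rewrite !mem_imset // !mem_fiber_base => yF xF.
  have FE : F = [set sx; sy].
    by move: xF yF; case: (fiber_pairP FF) => -> //; rewrite !inE.
  constructor 3; split=> [|j jN].
    by apply/negP => /su; rewrite mem_imset // mem_fiber_base FE !inE.
  apply/negP => /su; rewrite mem_imset // mem_base_fiber // => jt.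
  have := nbT (exist _ j jN); rewrite /blown_triple; apply/negP; rewrite negbK.
  apply/subsetP => q /setUP [/set2P [] | /set1P] -> /=.
  - by rewrite mem_base_fiber.
  - by rewrite mem_fiber_base.
  - by rewrite mem_fiber_base.
have [FE kt] := blown_fiber FF bT.
have zs : old sz \notin s.
  apply/negP => /su; rewrite inE mem_imset // inE mem_fiber_base FE !inE /=.
  by move=> /(subsetP (five_sub hG)); rewrite !inE.
(* By disjointness $v_k$ is the only NHC ray of [t]. The subdivision removes it from the old part,
   so it can only come back through [G]. *)
have js j : j \in NHC -> old (sbase j) \in s -> old (sbase (val k)) \in G.
  move=> jN /su; rewrite inE mem_imset // inE mem_base_fiber //.
  have [-> | jk] := eqVneq j (val k).
    by rewrite !inE eqxx /=.
  case/orP=> [/andP [_ jt] | /(subsetP (five_sub hG))].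
    by have := NHC_disjoint jN (valP k) jk tS; rewrite jt kt.
  rewrite !inE /= !orbF => /eqP [] E; by rewrite E eqxx in jk.
have xG : old sx \in s -> old sx \in G.
  by move/su; rewrite inE mem_imset // inE !inE eqxx orbT.
have yG : old sy \in s -> old sy \in G.
  by move/su; rewrite inE mem_imset // inE !inE eqxx !orbT.
have eG i : e1 i \in s -> e1 i \in G /\ i = k.
  move/su; rewrite inE [_ \in old @: _](negbTE (inrN _ _)) /= => h; split=> //.
  move/(subsetP (five_sub hG)): h; rewrite !inE /=.
  by case/orP=> /eqP [].
have [xs|] := boolP (old sx \in s); last by constructor 1.
have [vs|vs] := boolP (old (sbase (val k)) \in G); last first.
  by constructor 3; split=> // j jN; apply: contra vs; apply: js.
constructor 2.
(* Among the five replacements, this is the only one containing both $v_k$ and $v_x$. *)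
have GE : G = [set old (sbase (val k)); old sx; e2 k].
  move: (xG xs) vs; move: hG; rewrite !inE.
  by case/orP => [/orP [/orP [/orP [] | ] | ] | ] /eqP -> //; rewrite !inE.
split=> [|i].
  by apply/negP => /yG; rewrite GE !inE.
by apply/negP => /eG [+ _]; rewrite GE !inE => /eqP [].
Qed.

(** * Characters of $V_6$ and the projection to the base *)

Definition lift_character (m : 'rV[int]_4) : 'rV[int]_(4 + 2) := row_mx m 0.

Lemma lift_character_is_additive : zmod_morphism lift_character.
Proof. by move=> m m'; rewrite /lift_character opp_row_mx add_row_mx oppr0 addr0. Qed.

HB.instance Definition _ := GRing.isZmodMorphism.Build _ _ lift_character
  lift_character_is_additive.

Local Arguments sgen : simpl never.

Lemma pairing_sgen (m : 'rV[int]_4) (m' : 'rV[int]_2) r :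
  pairing (row_mx m m') (sgen v b r) =
  match r with
  | inl i => pairing m (v i) + m' 0 1 * (1 - b i)
  | inr k => tnth [tuple m' 0 0 * 3 + m' 0 1; m' 0 0 * -2 - m' 0 1; m' 0 1] k
  end.
Proof.
have p2 a c : pairing m' (vec2 a c) = m' 0 0 * a + m' 0 1 * c.
  rewrite /pairing !big_ord_recl big_ord0 addr0 !mxE /=.
  by congr (_ + m' 0 _ * c); apply: val_inj.
case: r => [i|k]; rewrite /sgen pairing_row_mx.
  by rewrite p2 mulr0 add0r.
have -> : pairing m 0 = 0 by rewrite /pairing big1 // => i _; rewrite mxE mulr0.
rewrite add0r; case: k => [[|[|[|k]]] hk] //=.
all: rewrite /tnth /= p2 ?mulr1 ?mulrN1 ?mulr0 ?add0r //.
Qed.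

(** The principal divisors of the fiber characters; these relate the three forms of $D_W$. *)
Lemma pairing_ugen m' r :
  pairing (row_mx 0 m') (gen (r : ray V6)) =
  match r with
  | inl (inl i) => m' 0 1 * (1 - b i)
  | inl (inr k) => tnth [tuple m' 0 0 * 3 + m' 0 1; m' 0 0 * -2 - m' 0 1; m' 0 1] k
  | inr (i, false) => m' 0 1 * (1 - b (val i)) - m' 0 0 - m' 0 1
  | inr (i, true) => (m' 0 1 * (1 - b (val i))) *+ 2 - m' 0 1
  end.
Proof.
case: r => [r | [i []]] /=; rewrite ?pairingDr ?pairingMnr !pairing_sgen /=.
- by case: r => [i|//]; rewrite pairing0l add0r.
- by rewrite pairing0l /tnth /=; ring.
- by rewrite pairing0l /tnth /=; ring.
Qed.

Lemma sum_delta (F : 'I_n -> int) j : \sum_i (i == j)%:R * F i = F j.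
Proof.
rewrite (bigD1 j) //= eqxx mul1r big1 ?addr0 // => i /negbTE ->.
by rewrite mul0r.
Qed.

Lemma sum_proj_coef (F : 'I_n -> int) r :
  \sum_i proj_coef r i * F i =
  match r with
  | inl (inl j) => F j
  | inl (inr _) => 0
  | inr (j, e) => F (val j) *+ e.+1
  end.
Proof.
case: r => [[j|k] | [j e]] /=; first exact: sum_delta.
  by rewrite big1 // => i _; rewrite mul0r.
rewrite -(sum_delta F) -sumrMnl; apply: eq_bigr => i _.
by rewrite mulrnAl.
Qed.

Lemma pairing_lift m r :
  pairing (lift_character m) (gen (r : ray V6)) =
  \sum_i proj_coef r i * pairing m (v i).
Proof.
rewrite sum_proj_coef.
case: r => [r | [i []]] /=; rewrite ?pairingDr ?pairingMnr !pairing_sgen /tnth /= !mxE.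
- case: r => [i|k]; first by rewrite mul0r addr0.
  by case: k => [[|[|[|k]]] hk].
- by ring.
- by ring.
Qed.

Lemma proj_coef_ge0 r i : 0 <= proj_coef r i.
Proof. by case: r => [[j|k] | [j e]] //=; rewrite ?mulrn_wge0. Qed.

Lemma image_cone_in (s : {set uray}) :
  s \in cones V6 -> image_cone (V := V) (V' := V6) proj_coef s \in cones V.
Proof.
case/cone_V6_image => t tS hs; apply: (Sigma_faces tS).
by apply/subsetP => i; rewrite inE => /exists_inP [r rs]; apply: hs.
Qed.

Lemma cartier_nef_projection (D : divisor V) (D' : divisor V6) :
  (forall r, D' r = \sum_i proj_coef r i * D i) ->
  cartier D -> nef D -> cartier D' /\ nef D'.
Proof.
move=> D'E cD nD; split.
  exact: (cartier_pullback (V := V) (V' := V6) (pm := lift_character)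
    (c := proj_coef) pairing_lift image_cone_in D'E).
exact: (nef_pullback (V := V) (V' := V6) (pm := lift_character)
  proj_coef_ge0 pairing_lift image_cone_in D'E).
Qed.

(** * Three linearly equivalent forms of $D_W$ *)

Definition two_Dy : divisor V6 := fun r =>
  match r with
  | inl r => 2 * (r == sy)%:R
  | inr (_, e) => (~~ e)%:R
  end.

(** [two_Dy] is the divisor of the monomial $y^2\prod e_{i,1}$ of $P_W$, where the Boolean false
    marks $e_{i,1}$. The character used is the quotient of this monomial by $x^3$. *)
Lemma three_Dx_two_Dy : lin_equiv (three_Dx NHC : divisor V6) two_Dy.
Proof.
exists (row_mx 0 (vec2 (-1) 0)) => r; rewrite pairing_ugen !mxE /=.
case: r => [[i|k] | [i []]] //=; rewrite /three_Dx /=.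
- by rewrite mul0r.
- by case: k => [[|[|[|k]]] hk] //=.
- by ring.
- by ring.
Qed.

(* The divisor of the monomials of [g' z^6 prod x_i^3]. *)
Definition pullback_Dg'_plus : divisor V6 := fun r =>
  \sum_i proj_coef r i * Dg' b NHC i +
  match r with
  | inl (inl i) => 3 * (i \in NHC)%:R
  | inl (inr k) => 6 * (k == 2)%:R
  | inr _ => 0
  end.

Lemma three_Dx_pullback_Dg' :
  lin_equiv (three_Dx NHC : divisor V6) pullback_Dg'_plus.
Proof.
(* The two constants are forced by the values -3 at $v_x$ and 0 at $v_y$. The values are then 6 at
   $v_z$ and $6(1-b_i)$ at $v_i$, while $e_{i,1}$ and $e_{i,2}$ get once and twice $6(1-b_i)-3$,
   which is [Dg'] at an NHC ray. *)
exists (row_mx 0 (vec2 (-3) 6)) => r; rewrite pairing_ugen !mxE /=.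
rewrite /pullback_Dg'_plus sum_proj_coef.
case: r => [[i|k] | [i []]] //=; rewrite /three_Dx /= /Dg' /KB ?(valP i) /=.
- by ring.
- by case: k => [[|[|[|k]]] hk] //=.
- by ring.
- by ring.
Qed.

Lemma three_Dx_cartier_nef (DW : divisor V6) :
  cartier (Dg' b NHC : divisor V) -> nef (Dg' b NHC : divisor V) ->
  lin_equiv DW (three_Dx NHC) -> cartier DW /\ nef DW.
Proof.
move=> cD nD DWE; apply: cartier_nef_plus_effective => s sV.
case: (cone_V6_cases sV) => [xs | [ys es] | [zs vs]].
- exists (fun=> 0), (three_Dx NHC); split=> //.
  + exact: cartier0.
  + exact: nef0.
  + by move=> r; rewrite /three_Dx mulr_ge0.
  + move=> r rs; rewrite /three_Dx; case: eqP => [E|_]; last by rewrite mulr0.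
    by rewrite -E rs in xs.
- exists (fun=> 0), two_Dy; split.
  + exact: cartier0.
  + exact: nef0.
  + exact: lin_equiv_trans DWE three_Dx_two_Dy.
  + by case=> [r | [i []]] //=; rewrite mulr_ge0.
  + move=> [r | [i []]] //= rs; last by rewrite (negbTE (es i)) in rs.
    by case: eqP rs => [-> rs | _ _]; [rewrite rs in ys | rewrite mulr0].
- have [cP nP] := cartier_nef_projection (fun _ => erefl) cD nD.
  exists (fun r => \sum_i proj_coef r i * Dg' b NHC i), pullback_Dg'_plus.
  split=> //.
  + exact: lin_equiv_trans DWE three_Dx_pullback_Dg'.
  + by move=> r; rewrite lerDl; case: r => [[i|k] | r] //; rewrite mulr_ge0.
  + move=> r rs; rewrite /pullback_Dg'_plus; case: r rs => [[i|k] | r] rs /=.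
    * case: (boolP (i \in NHC)) => [/vs | _]; last by rewrite mulr0 addr0.
      by rewrite rs.
    * case: eqP rs => [-> rs | _ _]; last by rewrite mulr0 addr0.
      by rewrite rs in zs.
    * by rewrite addr0.
Qed.

(** Every generator of $V_6$ projects to 0 or to a positive multiple of a single [v j], so the
    piecewise linear function need only be evaluated on the zero cone and on single rays. *)
Lemma is_pullback_proj_coef (D : divisor V) (D' : divisor V6) :
  set0 \in Sigma -> (forall i, [set i] \in Sigma) ->
  is_pullback (@V6_to_base) D D' ->
  forall r, D' r = \sum_i proj_coef r i * D i.
Proof.
move=> S0 S1 hD r; rewrite sum_proj_coef.
have hE j k : V6_to_base (gen (r : ray V6)) = v j *+ k -> D' r = D j *+ k.
  move=> E; apply: (@intr_inj real).
  rewrite (hD r [set j] (fun=> k%:R)) ?big_set1 //.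
  - by rewrite -[in RHS]mulr_natl intrM; congr (_ * _); rewrite natz pmulrn.
  - by rewrite E raddfMn scaler_nat.
have h0 : V6_to_base (gen (r : ray V6)) = 0 -> D' r = 0.
  move=> E; apply: (@intr_inj real).
  by rewrite (hD r set0 (fun=> 0)) ?big_set0 // E raddf0.
have toD : {morph @lsubmx int 1 4 2 : x y / x + y} := raddfD _.
have to_sgen q : lsubmx (sgen v b q) = if q is inl i then v i else 0.
  by case: q => [i|k]; rewrite row_mxKl.
case: r hE h0 => [[j|k] | [j []]] /= hE h0.
- by rewrite (hE j 1) // /V6_to_base row_mxKl.
- by rewrite h0 // /V6_to_base row_mxKl.
- by apply: hE; rewrite /V6_to_base !toD !to_sgen !addr0.
- by apply: hE; rewrite /V6_to_base !toD !to_sgen !addr0.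
Qed.

End Uplift.

Theorem lemma8
    (n : nat) (v : 'I_n -> 'rV[int]_4) (Sigma : {set {set 'I_n}})
    (b : 'I_n -> int) (NHC : {set 'I_n})
    (Sigma_simplicial : simplicial_fan (base v Sigma))
    (Sigma_complete : complete_fan (base v Sigma))
    (DB_orientifold : orientifold v b)
    (DB_irreducible : for_general_section v b (not_factorizable v))
    (DB_full_dim : full_dim_newton v b)
    (NHC_def : forall i, i \in NHC <-> NHC_ray v b i)
    (NHC_I0star : type_I0star v b NHC)
    (DB_cartier : cartier (b : divisor (base v Sigma)))
    (DB_nef : nef (b : divisor (base v Sigma)))
    (Dg'_cartier : cartier (Dg' b NHC : divisor (base v Sigma)))
    (Dg'_nef : nef (Dg' b NHC : divisor (base v Sigma)))
    (NHC_disjoint : forall i j s, i \in NHC -> j \in NHC -> i != j ->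
       s \in Sigma -> ~~ ((i \in s) && (j \in s))) :
  (forall DB : divisor (V6 v Sigma b NHC),
     is_pullback (@V6_to_base) (b : divisor (base v Sigma)) DB ->
     cartier DB /\ nef DB) /\
  (forall DW : divisor (V6 v Sigma b NHC),
     lin_equiv DW (three_Dx NHC) -> cartier DW /\ nef DW).
Proof.
have Sigma_faces := fan_faces Sigma_simplicial.
(* Completeness supplies at least one cone, and the zero cone is a face of it. *)
have Sigma_0 : set0 \in Sigma.
  by have [s sS _] := Sigma_complete 0; apply: (Sigma_faces s) (sub0set s).
split=> [DB hDB | DW hDW]; last exact: three_Dx_cartier_nef hDW.
apply: (cartier_nef_projection Sigma_faces _ DB_cartier DB_nef).
exact: is_pullback_proj_coef Sigma_0 (fan_rays Sigma_simplicial) hDB.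
Qed.
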